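(* Let $K$ be either a homogeneous self-similar set in $\mathbb{R}^d$ for some $d\ge1$, or a (not necessarily homogeneous) self-similar set in $\mathbb{R}^d$ with $d\in\{1,2\}$, and suppose that $K$ is not a singleton. Then $K$ has the positive dimension sumset property (PDSP): $\dim_H K>0$, and for any integer $\ell\ge2$ there exist compact sets $K_1,K_2,\ldots,K_\ell\subset\mathbb{R}^d$ such that $$K_1+K_2+\cdots+K_\ell\subset K\quad\text{and}\quad \dim_H K_i>0\quad\text{for all }1\le i\le\ell .$$
   Context: $\dim_H$ denotes Hausdorff dimension, and $K_1+\cdots+K_\ell=\{x_1+\cdots+x_\ell : x_i\in K_i,\ 1\le i\le\ell\}$. A non-empty compact set $K\subset\mathbb{R}^d$ is a self-similar set if there is a finite iterated function system $\{f_j(x)=\rho_jO_jx+b_j\}_{j=1}^m$ with each $\rho_j\in(0,1)$, $b_j\in\mathbb{R}^d$, and $O_j$ a $d\times d$ orthogonal real matrix, such that $K=\bigcup_{j=1}^m f_j(K)$. It is homogeneous if it is generated by such a system in which all $\rho_jO_j$, $1\le j\le m$, are identical. No separation condition is assumed. *)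

(* Defs.v *)
From HB Require Import structures.
From mathcomp Require Import all_boot all_order all_algebra.
From mathcomp Require Import all_classical all_reals all_analysis.

Set Implicit Arguments.
Unset Strict Implicit.
Unset Printing Implicit Defensive.

Import Order.TTheory GRing.Theory Num.Theory.
Import numFieldNormedType.Exports.

Local Open Scope classical_set_scope.
Local Open Scope ring_scope.

(* The library norm on matrices is the sup norm, so the Euclidean distance is
   spelled out; both induce the library's (product) topology on 'cV[R]_d. *)
Definition edist (R : realType) (d : nat) (x y : 'cV[R]_d) : R :=
  Num.sqrt (\sum_(i < d) (x i ord0 - y i ord0) ^+ 2).

(* Equal to -oo on set0. *)
Definition ediam (R : realType) (d : nat) (U : set 'cV[R]_d) : \bar R :=
  ereal_sup [set (edist x y)%:E | x in U & y in U].

(* diam(U)^s, with 0^0 = 1 on nonempty sets, and 0 on the empty set, so that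
   the case s = 0 below gives the counting measure. *)
Definition diam_pow (R : realType) (d : nat) (s : R) (U : set 'cV[R]_d) :
    \bar R :=
  if U == set0 then 0%E else poweR (ediam U) s.

Definition delta_cover (R : realType) (d : nat) (delta : R)
    (A : set 'cV[R]_d) (U : nat -> set 'cV[R]_d) : Prop :=
  A `<=` \bigcup_k U k /\ forall k, (ediam (U k) <= delta%:E)%E.

Definition hausdorff_pre (R : realType) (d : nat) (s delta : R)
    (A : set 'cV[R]_d) : \bar R :=
  ereal_inf [set (\sum_(k <oo) diam_pow s (U k))%E | U in delta_cover delta A].

(* The pre-measures are nonincreasing in delta, so the supremum is the limit
   as delta tends to 0. *)
Definition hausdorff_measure (R : realType) (d : nat) (s : R)
    (A : set 'cV[R]_d) : \bar R :=
  ereal_sup [set hausdorff_pre s delta A | delta in [set delta | 0 < delta]].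

Definition dimH (R : realType) (d : nat) (A : set 'cV[R]_d) : \bar R :=
  ereal_inf [set s%:E | s in [set s | 0 <= s /\ hausdorff_measure s A = 0%E]].

Definition orthogonal_mx (R : realType) (d : nat) (O : 'M[R]_d) : Prop :=
  O *m O^T = 1%:M.

Record similarity_ifs (R : realType) (d : nat) := SimilarityIFS {
  ifs_size : nat;
  ifs_ratio : 'I_ifs_size -> R;
  ifs_orth : 'I_ifs_size -> 'M[R]_d;
  ifs_shift : 'I_ifs_size -> 'cV[R]_d;
  ifs_ratioP : forall j, 0 < ifs_ratio j < 1;
  ifs_orthP : forall j, orthogonal_mx (ifs_orth j)
}.

Definition ifs_linear (R : realType) (d : nat) (F : similarity_ifs R d)
    (j : 'I_(ifs_size F)) : 'M[R]_d :=
  ifs_ratio j *: ifs_orth j.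

Definition ifs_map (R : realType) (d : nat) (F : similarity_ifs R d)
    (j : 'I_(ifs_size F)) (x : 'cV[R]_d) : 'cV[R]_d :=
  ifs_linear j *m x + ifs_shift j.

(* K !=set0 forces the system to have at least one map. *)
Definition generates (R : realType) (d : nat) (F : similarity_ifs R d)
    (K : set 'cV[R]_d) : Prop :=
  [/\ K !=set0, compact K &
      K = \bigcup_(j in [set: 'I_(ifs_size F)]) (ifs_map j @` K)].

Definition self_similar (R : realType) (d : nat) (K : set 'cV[R]_d) : Prop :=
  exists F : similarity_ifs R d, generates F K.

Definition homogeneous_self_similar (R : realType) (d : nat)
    (K : set 'cV[R]_d) : Prop :=
  exists2 F : similarity_ifs R d, generates F K &
    forall i j : 'I_(ifs_size F), ifs_linear i = ifs_linear j.

Definition sumset (R : realType) (d l : nat) (K : 'I_l -> set 'cV[R]_d) :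
    set 'cV[R]_d :=
  [set \sum_(i < l) x i | x in [set x : 'I_l -> 'cV[R]_d | forall i, K i (x i)]].

Definition PDSP (R : realType) (d : nat) (K : set 'cV[R]_d) : Prop :=
  (0 < dimH K)%E /\
  forall l : nat, (2 <= l)%N ->
    exists Ks : 'I_l -> set 'cV[R]_d,
      [/\ forall i, compact (Ks i),
          sumset Ks `<=` K &
          forall i, (0 < dimH (Ks i))%E].

(* Main.v *)
(* If f_i and f_j are two of the generating maps, the linear parts of f_i^2
   and f_j^2 commute: trivially in the homogeneous case and for d = 1, and as
   rotations for d = 2.  If f_i^2 f_j^2 = f_j^2 f_i^2 for all i and j, then all
   the f_j have a common fixed point and K is this point.  Otherwise K is mapped
   into itself by two maps A x + b0 and A x + b1 with b0 <> b1 and A a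
   similarity.  With p the fixed point of the first map and c = b1 - b0, K then
   contains all p + sum_k w_k A^k c with digits w_k in {0, 1}.  Splitting the
   exponents k into residue classes modulo some N >= l, large enough for A^N to
   have ratio r <= 1/4, K_i is the closure of the set of the
   p / l + sum_n w_n A^(nN + i) c.
   A real x in [0, 1) with binary digits w_n is sent to the point of K_i with
   digits w_n; since r <= 1/4 the inverse of this map is Hoelder of exponent s0,
   where r^s0 = 1/2, so a cover of K_i yields a cover of [0, 1) by intervals,
   and sigma-subadditivity of Lebesgue measure gives dim_H K_i >= s0 > 0. *)
Require Import Defs.
From mathcomp Require Import all_boot all_order all_algebra.
From mathcomp Require Import all_classical all_reals all_analysis.
From mathcomp Require Import ring lra.

Import Order.TTheory GRing.Theory Num.Theory.
Import numFieldNormedType.Exports.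
(* The library's [edist] would otherwise shadow the Euclidean distance. *)
Import Defs.

Set Implicit Arguments.
Unset Strict Implicit.
Unset Printing Implicit Defensive.

Local Open Scope classical_set_scope.
Local Open Scope ring_scope.

(** * Euclidean norm and linear similarities *)

Definition enorm (R : realType) (d : nat) (x : 'cV[R]_d) : R :=
  Num.sqrt (\sum_(i < d) x i ord0 ^+ 2).

Lemma edistE (R : realType) d (x y : 'cV[R]_d) : edist x y = enorm (x - y).
Proof. by congr Num.sqrt; apply: eq_bigr => i _; rewrite !mxE. Qed.

Lemma enorm_ge0 (R : realType) d (x : 'cV[R]_d) : 0 <= enorm x.
Proof. exact: sqrtr_ge0. Qed.

Lemma enorm_sqr (R : realType) d (x : 'cV[R]_d) :
  enorm x ^+ 2 = \sum_(i < d) x i ord0 ^+ 2.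
Proof. by rewrite sqr_sqrtr// sumr_ge0// => i _; exact: sqr_ge0. Qed.

Lemma enorm_eq0 (R : realType) d (x : 'cV[R]_d) : enorm x = 0 -> x = 0.
Proof.
move=> x0; have /esym/eqP := enorm_sqr x.
rewrite x0 expr0n psumr_eq0; last by move=> i _; exact: sqr_ge0.
move=> /allP xi0; apply/matrixP => i j; rewrite ord1 mxE.
by apply/eqP; rewrite -sqrf_eq0; apply: xi0; rewrite mem_index_enum.
Qed.

Lemma enorm0 (R : realType) d : enorm (0 : 'cV[R]_d) = 0.
Proof. by rewrite /enorm big1 ?sqrtr0// => i _; rewrite mxE expr0n. Qed.

Lemma enormN (R : realType) d (x : 'cV[R]_d) : enorm (- x) = enorm x.
Proof. by congr Num.sqrt; apply: eq_bigr => i _; rewrite mxE sqrrN. Qed.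

(* Summing the inequalities [2 |x| |y| x_i y_i <= |y|^2 x_i^2 + |x|^2 y_i^2]
   gives Cauchy-Schwarz. *)
Lemma enormD (R : realType) d (x y : 'cV[R]_d) :
  enorm (x + y) <= enorm x + enorm y.
Proof.
have xge0 := enorm_ge0 x; have yge0 := enorm_ge0 y.
have [/enorm_eq0->|x0] := eqVneq (enorm x) 0; first by rewrite enorm0 !add0r.
have [/enorm_eq0->|y0] := eqVneq (enorm y) 0; first by rewrite enorm0 !addr0.
rewrite -(@ler_pXn2r _ 2)// ?nnegrE ?enorm_ge0 ?addr_ge0//.
have -> : enorm (x + y) ^+ 2 = enorm x ^+ 2 + enorm y ^+ 2
    + 2 * \sum_(i < d) x i ord0 * y i ord0.
  rewrite !enorm_sqr mulr_sumr -!big_split/=; apply: eq_bigr => i _.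
  by rewrite mxE; ring.
set S := \sum_(i < d) _.
suff : 2 * (enorm x * enorm y) * S <= 2 * (enorm x * enorm y) ^+ 2.
  have xy0 : 0 < enorm x * enorm y by rewrite mulr_gt0// lt_neqAle eq_sym
    ?x0 ?y0.
  have -> u : 2 * u ^+ 2 = 2 * u * u by rewrite expr2 mulrA.
  by rewrite ler_pM2l => [Sxy|]; [rewrite sqrrD; lra|exact: mulr_gt0].
have -> : 2 * (enorm x * enorm y) ^+ 2 =
    \sum_(i < d) (enorm y ^+ 2 * x i ord0 ^+ 2 + enorm x ^+ 2 * y i ord0 ^+ 2).
  by rewrite big_split -!mulr_sumr -!enorm_sqr/=; ring.
rewrite mulr_sumr ler_sum// => i _.
have := sqr_ge0 (enorm y * x i ord0 - enorm x * y i ord0); nra.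
Qed.

Lemma edistxx (R : realType) d (x : 'cV[R]_d) : edist x x = 0.
Proof. by rewrite edistE subrr enorm0. Qed.

Lemma edistC (R : realType) d (x y : 'cV[R]_d) : edist x y = edist y x.
Proof. by rewrite !edistE -enormN opprB. Qed.

Lemma edist_triangle (R : realType) d (y x z : 'cV[R]_d) :
  edist x z <= edist x y + edist y z.
Proof. by rewrite !edistE -[x - z](subrKA y) enormD. Qed.

Definition mx_similarity (R : realType) (d : nat) (r : R) (A : 'M[R]_d) :=
  forall x : 'cV[R]_d, enorm (A *m x) = r * enorm x.

Lemma mx_similarity_orthogonal (R : realType) d (r : R) (O : 'M[R]_d) :
  0 <= r -> orthogonal_mx O -> mx_similarity r (r *: O).
Proof.
move=> r0 /mulmx1C OTO x.
have tr y : y^T *m y = (enorm (y : 'cV[R]_d) ^+ 2)%:M.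
  apply/matrixP => i j; rewrite !ord1 !mxE eqxx mulr1n enorm_sqr.
  by apply: eq_bigr => k _; rewrite !mxE expr2.
have xO : enorm (O *m x) ^+ 2 = enorm x ^+ 2.
  have := tr (O *m x); rewrite trmx_mul mulmxA -(mulmxA _ O^T) OTO mulmx1 tr.
  by move/matrixP/(_ ord0 ord0); rewrite !mxE eqxx !mulr1n.
rewrite -scalemxAl; apply: (@pexpIrn _ 2) => //;
  rewrite ?nnegrE ?mulr_ge0 ?enorm_ge0//.
rewrite exprMn -xO [LHS]enorm_sqr enorm_sqr mulr_sumr.
by apply: eq_bigr => i _; rewrite mxE exprMn.
Qed.

Lemma mx_similarityM (R : realType) d (r s : R) (A B : 'M[R]_d) :
  mx_similarity r A -> mx_similarity s B -> mx_similarity (r * s) (A *m B).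
Proof. by move=> rA sB x; rewrite -mulmxA rA sB mulrA. Qed.

Lemma mx_similarityX (R : realType) d (r : R) (A : 'M[R]_d) n :
  mx_similarity r A -> mx_similarity (r ^+ n) (A ^+ n).
Proof.
move=> rA; elim: n => [|n IHn]; first by move=> x; rewrite !expr0 mul1mx mul1r.
by rewrite !exprS; exact: mx_similarityM.
Qed.

Lemma edist_affine (R : realType) d (r : R) (A : 'M[R]_d) b (x y : 'cV[R]_d) :
  mx_similarity r A -> edist (A *m x + b) (A *m y + b) = r * edist x y.
Proof. by move=> rA; rewrite !edistE opprD addrACA subrr addr0 -mulmxBr rA. Qed.

(** * Continuity, compactness and fixed points *)

Lemma edist_continuous (T : topologicalType) (R : realType) d
    (f g : T -> 'cV[R]_d) :
  (forall i, continuous (fun t => f t i ord0)) ->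
  (forall i, continuous (fun t => g t i ord0)) ->
  continuous (fun t => edist (f t) (g t)).
Proof.
move=> cf cg t; apply: (@continuous_comp _ _ _ _ (@Num.sqrt R));
  last exact: sqrt_continuous.
apply: (continuous_big add_continuous) => i _ {}t.
apply: (@continuous_comp _ _ _ (fun t => f t i ord0 - g t i ord0)
  (fun x : R => x ^+ 2)); last exact: exprn_continuous.
by apply: continuousB; [exact: cf|exact: cg].
Qed.

Lemma affine_coord_continuous (R : realType) d (A : 'M[R]_d) b i :
  continuous (fun x : 'cV[R]_d => (A *m x + b) i ord0).
Proof.
under eq_fun do rewrite !mxE; move=> x.
apply: continuousD; last exact: cst_continuous.
apply: (continuous_big add_continuous) => j _ {}x.
apply: continuousM; first exact: cst_continuous.
exact: coord_continuous.
Qed.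

Lemma closed_eball (R : realType) d (c : 'cV[R]_d) (r : R) :
  closed [set x | edist x c <= r].
Proof.
apply: (@closed_comp _ _ (fun x : 'cV[R]_d => edist x c) [set x | x <= r]).
  move=> x _; apply: edist_continuous => i; first exact: coord_continuous.
  exact: cst_continuous.
exact: closed_le.
Qed.

(** A cluster point replaces the limit: a closed ball that contains a tail of the sequence contains
    all its cluster points. *)
Lemma compact_limit (R : realType) d (K : set 'cV[R]_d) (u : nat -> 'cV[R]_d) :
  compact K -> (forall n, K (u n)) -> exists2 z, K z &
    forall c r n0, (forall n, (n0 <= n)%N -> edist (u n) c <= r) ->
      edist z c <= r.
Proof.
move=> cK Ku.
have [|z [Kz uz]] := cK (u @ \oo) _; first by exists 0%N => // n _; exact: Ku.
exists z => // c r n0 ur; rewrite clusterE in uz.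
have := uz [set x | edist x c <= r]; rewrite -(closure_id _).1; last first.
  exact: closed_eball.
by apply; exists n0.
Qed.

(** A point of [K] with least displacement is fixed, since its image is a point of [K] whose
    displacement is [r < 1] times as large. *)
Lemma affine_fixpoint (R : realType) d (r : R) (A : 'M[R]_d) b
    (K : set 'cV[R]_d) :
  r < 1 -> mx_similarity r A -> K !=set0 -> compact K ->
  (forall x, K x -> K (A *m x + b)) -> exists2 p, K p & A *m p + b = p.
Proof.
move=> r1 rA K0 cK AK.
have [|p /set_mem Kp pmin] := @compact_EVT_min _ R
    (fun x : 'cV[R]_d => edist x (A *m x + b)) K K0 cK.
  apply: continuous_subspaceT; apply: edist_continuous => i.
    exact: coord_continuous.
  exact: affine_coord_continuous.
exists p => //; apply/eqP; rewrite eq_sym -subr_eq0; apply/eqP/enorm_eq0.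
have := pmin _ (mem_set (AK _ Kp)); rewrite (edist_affine _ _ _ rA) edistE => H.
apply/eqP; rewrite eq_le enorm_ge0 andbT; nra.
Qed.

(** * Lower bounds for Hausdorff dimension *)

Lemma edist_le_ediam (R : realType) d (U : set 'cV[R]_d) x y :
  U x -> U y -> ((edist x y)%:E <= ediam U)%E.
Proof. by move=> Ux Uy; apply: ereal_sup_ubound; exists x => //; exists y. Qed.

(** By the Hoelder bound, the parameters sent into [U] lie within [c * D ^ s] of any one of them,
    where [D] is the diameter of [U]. *)
Lemma parametrized_diam_cover (R : realType) d (g : R -> 'cV[R]_d) (s s0 c : R)
    (U : set 'cV[R]_d) :
  0 <= s < s0 -> 0 < c ->
  (forall x y : R, 0 <= x < 1 -> 0 <= y < 1 ->
    `|x - y| <= c * edist (g x) (g y) `^ s0) ->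
  (ediam U <= 1)%E ->
  exists2 I : set R, measurable I /\ [set x | 0 <= x < 1 /\ U (g x)] `<=` I &
    (lebesgue_measure I <= (2 * c)%:E * diam_pow s U)%E.
Proof.
move=> /andP[s_ge0 ss0] c0 gs0 U1.
have diam0 : (0 <= diam_pow s U)%E.
  by rewrite /diam_pow; case: ifP => _ //; exact: poweR_ge0.
(* If no parameter lands in [U], the empty set serves; otherwise [U] is nonempty and its diameter is
   a real number in [0, 1]. *)
have [V0|/set0P[x0 [x01 Ux0]]] := eqVneq [set x | 0 <= x < 1 /\ U (g x)] set0.
  exists set0; first by rewrite V0; split.
  by rewrite measure0 mule_ge0// lee_fin mulr_ge0// ltW.
have D0 : (0 <= ediam U)%E.
  by rewrite (le_trans _ (edist_le_ediam Ux0 Ux0))// lee_fin edistxx.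
have [D Ddef] : exists D, ediam U = D%:E.
  exists (fine (ediam U)); rewrite fineK// ge0_fin_numE//.
  exact: le_lt_trans U1 (ltry _).
have -> : diam_pow s U = (D `^ s)%:E.
  rewrite /diam_pow ifF; first by rewrite Ddef poweR_EFin.
  by apply/negbTE/set0P; exists (g x0).
rewrite Ddef !lee_fin in U1 D0.
pose e := c * D `^ s.
have e0 : 0 <= e by rewrite mulr_ge0 ?powR_ge0// ltW.
exists `[x0 - e, x0 + e]%classic.
  split=> // x [x01' Ux] /=.
  suff : `|x - x0| <= e by rewrite in_itv/= ler_distl.
  apply: (le_trans (gs0 _ _ x01' x01)); rewrite ler_pM2l//.
  have : edist (g x) (g x0) <= D.
    by rewrite -lee_fin -Ddef edist_le_ediam.
  have := sqrtr_ge0 (\sum_(i < d) (g x i ord0 - g x0 i ord0) ^+ 2).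
  rewrite -/(edist _ _) le_eqVlt => /predU1P[<- _|t0 tD].
    by rewrite powR0 ?powR_ge0// gt_eqF// (le_lt_trans s_ge0).
  (* For [t] the distance from [g x] to [g x0], [0 < t <= D <= 1] and [s < s0] give
     [t ^ s0 <= t ^ s <= D ^ s]. *)
  apply: (le_trans (ger_powR _ (ltW ss0))).
    by rewrite t0 (le_trans tD).
  by rewrite ge0_ler_powR// ?nnegrE ltW.
rewrite lebesgue_measure_itv /=; case: ifP => _.
  by rewrite -EFinB -EFinM lee_fin /e; lra.
by rewrite -EFinM lee_fin !mulr_ge0// ?powR_ge0// ltW.
Qed.

(** A cover of [A] by sets of diameter at most 1 pulls back along [g] to a cover of [0, 1) by sets
    of total length at least 1, which bounds the pre-measure below by [(2 * c)^-1]. *)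
Lemma hausdorff_pre_gt0 (R : realType) d (g : R -> 'cV[R]_d) (s s0 c : R)
    (A : set 'cV[R]_d) :
  0 <= s < s0 -> 0 < c -> (forall x : R, 0 <= x < 1 -> A (g x)) ->
  (forall x y : R, 0 <= x < 1 -> 0 <= y < 1 ->
    `|x - y| <= c * edist (g x) (g y) `^ s0) ->
  (0 < hausdorff_pre s 1 A)%E.
Proof.
move=> ss0 c0 Ag gs0; apply: (@lt_le_trans _ _ (2 * c)^-1%:E).
  by rewrite lte_fin invr_gt0 mulr_gt0.
apply/ereal_infP => _ [U [AU U1] <-].
have cover_k k := cid2 (parametrized_diam_cover ss0 c0 gs0 (U1 k)).
pose I k := s2val (cover_k k).
rewrite -(@lee_pmul2l _ (2 * c)%:E)// ?lte_fin ?mulr_gt0//.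
rewrite -EFinM divff ?gt_eqF ?mulr_gt0// -nneseriesZl; last first.
  by move=> k _; rewrite /diam_pow; case: ifP => // _; exact: poweR_ge0.
have -> : 1%:E = lebesgue_measure (`[0%R, 1%R[%classic : set R).
  by rewrite lebesgue_measure_itv/= lte_fin ltr01 oppr0 adde0.
apply: (@le_trans _ _ (\sum_(k <oo) lebesgue_measure (I k))%E).
  apply: measure_sigma_subadditive => //.
  - by move=> k; have [] := s2valP (cover_k k).
  - move=> x; rewrite /= in_itv/= => x01; have [k _ Uk] := AU _ (Ag _ x01).
    by exists k => //; have [_] := s2valP (cover_k k); apply.
by apply: lee_nneseries => // k _; exact: s2valP' (cover_k k).
Qed.

Lemma dimH_gt0 (R : realType) d (g : R -> 'cV[R]_d) (s0 c : R)
    (A : set 'cV[R]_d) :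
  0 < s0 -> 0 < c -> (forall x : R, 0 <= x < 1 -> A (g x)) ->
  (forall x y : R, 0 <= x < 1 -> 0 <= y < 1 ->
    `|x - y| <= c * edist (g x) (g y) `^ s0) ->
  (0 < dimH A)%E.
Proof.
move=> s00 c0 Ag gs0; apply: (@lt_le_trans _ _ s0%:E); first by rewrite lte_fin.
apply/ereal_infP => _ [s [s_ge0 Hs] <-]; rewrite lee_fin leNgt.
apply/negP => ss0.
have : (0 < hausdorff_measure s A)%E; last by rewrite Hs ltxx.
have ss : 0 <= s < s0 by rewrite s_ge0.
apply: (lt_le_trans (hausdorff_pre_gt0 ss c0 Ag gs0)).
(* The measure is a supremum over all scales, so the scale 1 bounds it below. *)
by apply: ereal_sup_ubound; exists 1 => //=.
Qed.

(** * Binary digits of reals in [0, 1) *)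

(** For [x] in [0, 1), digit [n] is the coefficient of 2^-(n+1) in the binary expansion that does
    not end in ones only. *)
Definition binary_digit (R : realType) (x : R) (n : nat) : bool :=
  odd (Num.truncn (2 ^+ n.+1 * x)).

Lemma truncn_double (R : realType) (x : R) :
  0 <= x ->
  Num.truncn (2 * x) = (odd (Num.truncn (2 * x)) + (Num.truncn x).*2)%N.
Proof.
move=> x0; set m := Num.truncn (2 * x).
suff -> : Num.truncn x = m./2 by rewrite odd_double_half.
have /truncn_itv : 0 <= 2 * x by rewrite mulr_ge0.
rewrite -/m => /andP[mx xm]; apply: truncn_def.
have /(congr1 (fun n => n%:R : R)) := odd_double_half m.
rewrite -muln2 !natrD natrM => mE.
have o1 : (odd m)%:R <= 1 :> R by case: odd.
have o0 : 0 <= (odd m)%:R :> R by [].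
rewrite -natr1 in xm; rewrite -natr1; apply/andP; split; last lra.
rewrite -(@ler_pM2l _ 2)//; lra.
Qed.

Lemma truncn_binary_digit (R : realType) (x y : R) n :
  0 <= x < 1 -> 0 <= y < 1 ->
  (forall k, (k < n)%N -> binary_digit x k = binary_digit y k) ->
  Num.truncn (2 ^+ n * x) = Num.truncn (2 ^+ n * y).
Proof.
move=> x01 y01; elim: n => [_|n IHn xy].
  by rewrite !expr0 !mul1r (@truncn_def _ x 0)// (@truncn_def _ y 0).
have pos z : 0 <= z < 1 -> 0 <= 2 ^+ n * z :> R.
  by move=> /andP[z0 _]; rewrite mulr_ge0// exprn_ge0.
rewrite exprS -!mulrA truncn_double ?pos// [RHS]truncn_double ?pos//.
rewrite !mulrA -!exprS; congr ((nat_of_bool _ + _.*2)%N); first exact: (xy n).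
by apply: IHn => k kn; apply: xy; exact: ltnW.
Qed.

(** The numbers [2 ^+ n * x] and [2 ^+ n * y] have the same integer part. *)
Lemma binary_digit_dist (R : realType) (x y : R) n :
  0 <= x < 1 -> 0 <= y < 1 ->
  (forall k, (k < n)%N -> binary_digit x k = binary_digit y k) ->
  `|x - y| <= 2^-1 ^+ n.
Proof.
move=> x01 y01 /(truncn_binary_digit x01 y01) xy.
have n0 : 0 < 2 ^+ n :> R by rewrite exprn_gt0.
have pos z : 0 <= z < 1 -> 0 <= 2 ^+ n * z :> R.
  by move=> /andP[z0 _]; rewrite mulr_ge0// ltW.
have /andP[x1 x2] := truncn_itv (pos _ x01).
have /andP[y1 y2] := truncn_itv (pos _ y01).
rewrite -xy -natr1 in y1 y2; rewrite -natr1 in x2.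
rewrite -(ler_pM2l n0) exprVn divff ?gt_eqF//.
rewrite -{1}(gtr0_norm n0) -normrM mulrBr ler_norml; apply/andP; split; lra.
Qed.

(** * Digit sums and the dimension of the sets containing them *)

Definition digit_sum (R : realType) d (B : 'M[R]_d) (v : 'cV[R]_d)
  (w : nat -> bool) n : 'cV[R]_d := \sum_(k < n | w k) B ^+ k *m v.

Lemma digit_sumS (R : realType) d (B : 'M[R]_d) (v : 'cV[R]_d) w n :
  digit_sum B v w n.+1 = digit_sum B v w n + (w n)%:R *: (B ^+ n *m v).
Proof.
rewrite /digit_sum big_mkcond big_ord_recr -big_mkcond /=.
by case: (w n); rewrite ?scale1r ?scale0r.
Qed.

Lemma digit_sum_tail (R : realType) d (r : R) (B : 'M[R]_d) (v : 'cV[R]_d)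
    w n m :
  0 <= r <= 4^-1 -> mx_similarity r B -> (n <= m)%N ->
  edist (digit_sum B v w m) (digit_sum B v w n) <= 4 / 3 * enorm v * r ^+ n.
Proof.
move=> /andP[r0 r4] rB /subnKC<-.
(* This sharper bound goes through the induction: a term of norm at most [enorm v * r ^+ k] is at
   most the increment [4 / 3 * enorm v * (r ^+ k - r ^+ k.+1)], because [r <= 4^-1]. *)
suff : edist (digit_sum B v w (n + (m - n))) (digit_sum B v w n)
    <= 4 / 3 * enorm v * (r ^+ n - r ^+ (n + (m - n))).
  move/le_trans; apply; have := enorm_ge0 v.
  by have := exprn_ge0 (n + (m - n)) r0; nra.
elim: (m - n)%N => [|j IHj]; first by rewrite addn0 edistxx subrr mulr0.
have last_term : edist (digit_sum B v w (n + j).+1) (digit_sum B v w (n + j))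
    <= enorm v * r ^+ (n + j).
  rewrite digit_sumS edistE addrC addKr.
  case: (w _); first by rewrite scale1r (mx_similarityX _ rB) mulrC.
  by rewrite scale0r enorm0 mulr_ge0 ?enorm_ge0 ?exprn_ge0.
rewrite addnS; apply: (le_trans (edist_triangle (digit_sum B v w (n + j)) _ _)).
apply: (le_trans (lerD last_term IHj)).
rewrite exprS.
have := mulr_ge0 (enorm_ge0 v) (exprn_ge0 (n + j) r0).
nra.
Qed.

(** The common prefix cancels and only [B ^+ n *m v] remains, up to sign. *)
Lemma digit_sum_first_difference (R : realType) d (r : R) (B : 'M[R]_d)
    (v : 'cV[R]_d) w w' n :
  mx_similarity r B -> (forall k, (k < n)%N -> w k = w' k) -> w n != w' n ->
  edist (digit_sum B v w n.+1) (digit_sum B v w' n.+1) = enorm v * r ^+ n.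
Proof.
move=> rB ww' wn; rewrite !digit_sumS edistE.
have -> : digit_sum B v w n = digit_sum B v w' n.
  by apply: eq_bigl => k; exact: ww'.
rewrite opprD addrACA subrr add0r -scalerBl.
have := mx_similarityX n rB v.
by case: (w n) (w' n) wn => -[]//= _;
  rewrite ?subr0 ?sub0r ?scaleN1r ?scale1r ?enormN => ->; rewrite mulrC.
Qed.

Lemma digit_sum_limit (R : realType) d (r : R) (B : 'M[R]_d) (q v : 'cV[R]_d)
    (C : set 'cV[R]_d) (w : nat -> bool) :
  0 <= r <= 4^-1 -> mx_similarity r B -> compact C ->
  (forall n, C (q + digit_sum B v w n)) ->
  exists2 z, C z &
    forall n, edist z (q + digit_sum B v w n) <= 4 / 3 * enorm v * r ^+ n.
Proof.
move=> r4 rB cC Cw; have [z Cz zlim] := compact_limit cC Cw.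
exists z => // n; apply: (zlim _ _ n) => m nm.
have := digit_sum_tail v w r4 rB nm.
by rewrite !edistE opprD addrACA subrr add0r.
Qed.

Lemma binary_digit_first_difference (R : realType) (x y : R) :
  0 <= x < 1 -> 0 <= y < 1 -> x != y ->
  exists2 n, (forall k, (k < n)%N -> binary_digit x k = binary_digit y k) &
    binary_digit x n != binary_digit y n.
Proof.
move=> x01 y01 xy.
have [|n nxy nmin] := @ex_minnP (fun n => binary_digit x n != binary_digit y n).
  apply: contrapT => noxy; have {}noxy k : binary_digit x k = binary_digit y k.
    by apply/eqP; apply: contrapT => /negP k_; apply: noxy; exists k.
  have xy_gt0 : 0 < `|x - y| by rewrite normr_gt0 subr_eq0.
  have /cvgr_lt/(_ _ xy_gt0)[n _ /(_ n (leqnn n))] :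
      (2^-1 : R) ^+ n @[n --> \oo] --> 0.
    by apply: cvg_expr; rewrite ger0_norm; lra.
  by rewrite ltNge binary_digit_dist.
exists n => // k kn; apply/eqP; apply: contraTT kn => /nmin.
by rewrite -leqNgt.
Qed.

Lemma dimH_digit_sums_gt0 (R : realType) d (r : R) (B : 'M[R]_d)
    (q v : 'cV[R]_d) (C : set 'cV[R]_d) :
  0 < r <= 4^-1 -> mx_similarity r B -> v != 0 -> compact C ->
  (forall w n, C (q + digit_sum B v w n)) -> (0 < dimH C)%E.
Proof.
move=> /andP[r_gt0 r4] rB v0 cC Cw.
have r04 : 0 <= r <= 4^-1 by rewrite ltW.
pose g (x : R) :=
  s2val (cid2 (digit_sum_limit r04 rB cC (Cw (binary_digit x)))).
have Cg x : C (g x) by exact: s2valP (cid2 _).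
have gP x n : edist (g x) (q + digit_sum B v (binary_digit x) n)
    <= 4 / 3 * enorm v * r ^+ n.
  exact: (s2valP' (cid2 (digit_sum_limit r04 rB cC (Cw (binary_digit x))))).
have v_gt0 : 0 < enorm v.
  rewrite lt_neqAle enorm_ge0 andbT eq_sym.
  by apply: contra v0 => /eqP/enorm_eq0 ->.
have r1 : r < 1 by lra.
have lnr : ln r < 0 by rewrite ln_lt0// r_gt0.
pose s0 := ln (2^-1 : R) / ln r.
have s0_gt0 : 0 < s0.
  by rewrite /s0 -mulrNN -invrN divr_gt0// oppr_gt0// ln_lt0//; lra.
have rs0 n : (r ^+ n) `^ s0 = 2^-1 ^+ n.
  have r_s0 : r `^ s0 = 2^-1.
    by rewrite /powR gt_eqF// /s0 divfK ?lt_eqF// lnK// posrE; lra.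
  by rewrite -powR_mulrn ?(ltW r_gt0)// powRAC r_s0 powR_mulrn// invr_ge0.
apply: (@dimH_gt0 _ _ g s0 ((3 / enorm v) `^ s0)) => //.
  by rewrite powR_gt0// divr_gt0.
move=> x y x01 y01.
have [->|xy] := eqVneq x y.
  by rewrite subrr normr0 mulr_ge0// powR_ge0.
have [n xyn nxy] := binary_digit_first_difference x01 y01 xy.
apply: (le_trans (binary_digit_dist x01 y01 xyn)).
have D0 : 0 <= edist (g x) (g y) by exact: sqrtr_ge0.
rewrite -powRM// ?divr_ge0 ?enorm_ge0// -rs0.
have cD0 : 0 <= 3 / enorm v * edist (g x) (g y).
  by rewrite mulr_ge0// divr_ge0 ?enorm_ge0.
have rn0 : 0 <= r ^+ n by rewrite exprn_ge0// ltW.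
apply: ge0_ler_powR (ltW s0_gt0) _ _ _ _ _; rewrite ?nnegrE//.
rewrite mulrAC ler_pdivlMr//.
have := digit_sum_first_difference v rB xyn nxy.
have := gP y n.+1; have := gP x n.+1.
set X := digit_sum _ _ _ _; set Y := digit_sum _ _ _ _ => xX yY XY.
have : edist (q + X) (q + Y) = edist X Y.
  by rewrite !edistE opprD addrACA subrr add0r.
have := edist_triangle (g x) (q + X) (q + Y).
have := edist_triangle (g y) (g x) (q + Y).
rewrite (edistC (q + X) (g x)) => gxy gxX XYq; rewrite XYq XY in gxX.
rewrite exprS in xX yY.
(* As [r <= 4^-1], each of the two tails is at most a third of [enorm v * r ^+ n], so a third of the
   gap between the partial sums survives. *)
have := ler_wpM2r (mulr_ge0 (enorm_ge0 v) rn0) r4.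
lra.
Qed.

(** * Interleaved digit sums and sumsets *)

Lemma digit_sum_widen (R : realType) d (B : 'M[R]_d) v w n m : (n <= m)%N ->
  digit_sum B v w n = digit_sum B v (fun k => w k && (k < n)%N) m.
Proof.
move=> nm.
by rewrite /digit_sum (big_ord_widen_cond m w (fun k => B ^+ k *m v)).
Qed.

(** Seen from [p], the two maps are [z] to [A *m z] and [z] to [c + A *m z]. Composing them along
    [w], with the last digit applied first, sends [y] to the stated point. *)
Lemma digit_sum_prefix (R : realType) d (A : 'M[R]_d) (p c : 'cV[R]_d)
    (K : set 'cV[R]_d) (w : nat -> bool) n y :
  (forall (e : bool) z, K (p + z) -> K (p + (e%:R *: c + A *m z))) ->
  K (p + y) -> K (p + (digit_sum A c w n + A ^+ n *m y)).
Proof.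
move=> KA; elim: n y => [|n IHn] y Ky.
  by rewrite /digit_sum big_ord0 add0r mul1mx.
rewrite digit_sumS -addrA exprSr -mulmxA scalemxAr -mulmxDr.
by apply: IHn; exact: KA.
Qed.

(** The [i]-th sum uses only the powers [A ^+ (k * N + i)], which are indexed by distinct exponents
    as [l <= N]; together the sums form one digit sum for [A]. The induction adds one block of [N]
    digits at a time. *)
Lemma interleaved_digit_sums (R : realType) d (A : 'M[R]_d) (p c : 'cV[R]_d)
    (K : set 'cV[R]_d) l N (w : 'I_l -> nat -> bool) n :
  (forall (e : bool) z, K (p + z) -> K (p + (e%:R *: c + A *m z))) ->
  K p -> (l <= N)%N ->
  K (p + \sum_(i < l) digit_sum (A ^+ N) (A ^+ i *m c) (w i) n).
Proof.
move=> KA Kp lN.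
suff: forall y, K (p + y) ->
    K (p + (\sum_(i < l) digit_sum (A ^+ N) (A ^+ i *m c) (w i) n
      + (A ^+ N) ^+ n *m y)).
  by move=> /(_ 0); rewrite mulmx0 !addr0; apply.
elim: n => [|n IHn] y Ky.
  by rewrite big1 ?add0r ?mul1mx// => i _; rewrite /digit_sum big_ord0.
under eq_bigr do rewrite digit_sumS scalemxAr.
rewrite big_split -mulmx_sumr -addrA exprSr -mulmxA -mulmxDr /=.
apply: IHn.
(* The digits of one block; the positions from [l] to [N - 1] are filled with 0. *)
pose e k := if insub k is Some i then w i n else false.
have -> : \sum_(i < l) (w i n)%:R *: (A ^+ i *m c) = digit_sum A c e N.
  transitivity (\sum_(k < N | e k && (k < l)%N) A ^+ k *m c); last first.
    apply: eq_bigl => k.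
    by rewrite /e; case: insubP => [i -> _|]; rewrite ?andbT ?andFb.
  rewrite -(big_ord_widen_cond N e (fun k => A ^+ k *m c))// [RHS]big_mkcond.
  apply: eq_bigr => i _; rewrite /e valK.
  by case: (w i n); rewrite ?scale1r ?scale0r.
exact: digit_sum_prefix.
Qed.

(** The summands pass to the closures one index at a time: with the others fixed, the admissible
    values of one summand form a closed set, by continuity of addition. *)
Lemma sumset_closure (R : realType) d l (F : 'I_l -> set 'cV[R]_d)
    (K : set 'cV[R]_d) :
  closed K -> sumset F `<=` K -> sumset (fun i => closure (F i)) `<=` K.
Proof.
move=> cK FK _ [x Fx <-].
suff {x Fx} sumK (j : nat) (x : 'I_l -> 'cV[R]_d) :
    (forall i : 'I_l, if (i < j)%N then closure (F i) (x i) else F i (x i)) ->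
    K (\sum_(i < l) x i).
  by apply: (sumK l) => i; rewrite ltn_ord; exact: Fx.
elim: j x => [x Fx|j IHj x Fx]; first by apply: FK; exists x.
have [lj|jl] := leqP l j.
  apply: IHj => i; have := Fx i.
  by rewrite !(leq_trans (ltn_ord i))// (leq_trans lj).
pose k := Ordinal jl; rewrite (bigD1 k)//=.
set s := \sum_(i < l | i != k) x i.
have closedZ : closed [set t | K (t + s)].
  apply: (@closed_comp _ _ (fun t : 'cV[R]_d => t + s)) => // t _.
  by apply: continuousD; [exact: cvg_id|exact: cst_continuous].
suff : F k `<=` [set t | K (t + s)].
  move=> /closureS; rewrite -[X in _ `<=` X](closure_id _).1//; apply.
  by have := Fx k; rewrite /= ltnSn.
move=> t Ft /=; have := IHj (fun i => if i == k then t else x i).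
rewrite (bigD1 k)//= eqxx; under eq_bigr => i /negbTE -> do [].
apply => i; have := Fx i; case: (eqVneq i k) => [->|ik].
  by rewrite /= ltnn.
by rewrite ltnS leq_eqVlt -[i == j :> nat]/(i == k) (negbTE ik).
Qed.

(** * Two maps with the same linear part *)

Lemma PDSP_of_two_maps (R : realType) d (rho : R) (A : 'M[R]_d) b0 b1
    (K : set 'cV[R]_d) :
  0 < rho < 1 -> mx_similarity rho A -> b0 != b1 -> K !=set0 -> compact K ->
  (forall x, K x -> K (A *m x + b0)) -> (forall x, K x -> K (A *m x + b1)) ->
  PDSP K.
Proof.
move=> /andP[rho0 rho1] rhoA b01 K0 cK Kb0 Kb1.
have [p Kp Ap] := affine_fixpoint rho1 rhoA K0 cK Kb0.
pose c := b1 - b0.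
have KA (e : bool) z : K (p + z) -> K (p + (e%:R *: c + A *m z)).
  move=> Kz; case: e; last first.
    by rewrite scale0r add0r -{1}Ap addrAC -mulmxDr; exact: Kb0.
  rewrite scale1r -{1}Ap [c + _]addrC addrACA -mulmxDr [b0 + _]addrC subrK.
  exact: Kb1.
have c0 i : A ^+ i *m c != 0.
  apply/eqP => /(congr1 (@enorm R d)); rewrite (mx_similarityX i rhoA) enorm0.
  move=> /eqP; rewrite mulf_eq0 expf_eq0 (gt_eqF rho0) andbF /=.
  by move=> /eqP/enorm_eq0/eqP; rewrite subr_eq0 eq_sym (negbTE b01).
have [N0 rhoN] : exists N0, forall n, (N0 <= n)%N -> rho ^+ n <= 4^-1.
  have /cvgr_le : rho ^+ n @[n --> \oo] --> 0.
    by apply: cvg_expr; rewrite gtr0_norm.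
  have q0 : 0 < 4^-1 :> R by [].
  by move=> /(_ _ q0)[N0 _ N0P]; exists N0.
have rN n : (N0 <= n)%N -> 0 < rho ^+ n <= 4^-1.
  by move=> /rhoN ->; rewrite exprn_gt0.
(* Interleaving with all digits outside class [i] equal to 0. *)
have single l N (i : 'I_l) w n : (l <= N)%N ->
    K (p + digit_sum (A ^+ N) (A ^+ i *m c) w n).
  move=> lN.
  have := interleaved_digit_sums
    (fun j => if j == i then w else fun=> false) n KA Kp lN.
  rewrite (bigD1 i)//= eqxx big1 ?addr0// => j /negbTE ->.
  by rewrite /digit_sum big_pred0.
split.
  (* For [K] itself a single class suffices; the exponent must be at least 1 for [single] to apply
     with [l = 1]. *)
  apply: (@dimH_digit_sums_gt0 _ _ (rho ^+ (maxn N0 1)) (A ^+ (maxn N0 1)) p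
    (A ^+ 0 *m c)) => //; first by rewrite rN// leq_maxl.
    exact: mx_similarityX.
  by move=> w n; apply: (single 1%N _ ord0); exact: leq_maxr.
(* [N0] makes the ratio at most 1/4 and [l] keeps the classes disjoint; the [l] copies of [q] add up
   to [p]. *)
move=> l l2; pose N := maxn N0 l; pose q := l%:R^-1 *: p.
have lN : (l <= N)%N by exact: leq_maxr.
pose E (i : 'I_l) := [set q + digit_sum (A ^+ N) (A ^+ i *m c) wn.1 wn.2
  | wn in [set: (nat -> bool) * nat]].
(* This translate of [K] contains every [E i], whence the compactness of the closures. *)
have cKq : compact ((fun x => x + (q - p)) @` K).
  apply: continuous_compact => //; apply: continuous_subspaceT => x.
  by apply: (@continuousD _ _ _ id (cst (q - p)));
    [exact: cvg_id|exact: cst_continuous].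
have cE i : compact (closure (E i)).
  apply: (@subclosed_compact _ _ _ _ cKq); first exact: closed_closure.
  apply: (@subset_trans _ (closure ((fun x => x + (q - p)) @` K))).
    apply: closureS => _ [[w n] _ <-] /=.
    exists (p + digit_sum (A ^+ N) (A ^+ i *m c) w n); first exact: single.
    by rewrite addrC addrA subrK.
  rewrite -(closure_id _).1//.
  exact: compact_closed (@norm_hausdorff _ _) cKq.
exists (fun i => closure (E i)); split => //.
  apply: sumset_closure; first exact: compact_closed (@norm_hausdorff _ _) cK.
  move=> _ [x Ex <-].
  have /choice[wn xE] : forall i : 'I_l, exists wn : (nat -> bool) * nat,
      q + digit_sum (A ^+ N) (A ^+ i *m c) wn.1 wn.2 = x i.
    by move=> i; have [wn _ <-] := Ex i; exists wn.
  (* The chosen points may have different lengths; zero digits bring them all to length [M]. *)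
  pose M := \max_(i < l) (wn i).2.
  have := interleaved_digit_sums
    (fun i k => (wn i).1 k && (k < (wn i).2)%N) M KA Kp lN.
  under eq_bigr do rewrite -digit_sum_widen ?leq_bigmax//.
  suff -> : p = \sum_(i < l) q.
    by rewrite -big_split; under eq_bigr do rewrite /= xE.
  rewrite sumr_const card_ord -scaler_nat scalerA divff ?scale1r//.
  by rewrite pnatr_eq0 -lt0n (leq_trans _ l2).
move=> i; apply: (@dimH_digit_sums_gt0 _ _ (rho ^+ N) (A ^+ N) q
  (A ^+ i *m c)) => //; first by rewrite rN// leq_maxl.
  exact: mx_similarityX.
by move=> w n; apply: subset_closure; exists (w, n).
Qed.

(** * Commuting squares and common fixed points *)

(** The square has determinant 1, so it is a rotation; the equations express the shape of a rotation
    matrix. *)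
Lemma orthogonal_mx2_sqr (R : realType) (O : 'M[R]_2) : orthogonal_mx O ->
  let S := O *m O in
  S (lift ord0 ord0) (lift ord0 ord0) = S ord0 ord0 /\
  S (lift ord0 ord0) ord0 = - S ord0 (lift ord0 ord0).
Proof.
move=> OOT; have OTO := mulmx1C OOT.
rewrite /= !mxE !big_ord_recl !big_ord0.
move: OOT OTO => /matrixP OOT /matrixP OTO.
have := OTO ord0 ord0; have := OOT (lift ord0 ord0) (lift ord0 ord0).
have := OOT ord0 (lift ord0 ord0); have := OTO ord0 (lift ord0 ord0).
have := OOT ord0 ord0.
rewrite !mxE !big_ord_recl !big_ord0 !mxE /= => H1 H2 H3 H4 H5; split.
  nra.
nra.
Qed.

(** Squaring removes reflections, which need not commute with rotations. What is left are scalars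
    for [d = 1] and matrices that multiply like complex numbers for [d = 2]. *)
Lemma orthogonal_sqr_comm (R : realType) d (O P : 'M[R]_d) : d = 1 \/ d = 2 ->
  orthogonal_mx O -> orthogonal_mx P ->
  (O *m O) *m (P *m P) = (P *m P) *m (O *m O).
Proof.
case=> d12; subst d => O1 P1.
  by apply/matrixP => i j; rewrite !ord1 !mxE !big_ord1 mulrC.
have [Od Oa] := orthogonal_mx2_sqr O1; have [Pd Pa] := orthogonal_mx2_sqr P1.
move: (O *m O) (P *m P) Od Oa Pd Pa => {O1 P1}O {}P Od Oa Pd Pa.
have ord2 (i : 'I_2) : i = ord0 \/ i = lift ord0 ord0.
  by case: i => [[|[|]]]// i; [left|right]; exact: val_inj.
apply/matrixP => i j; rewrite !mxE !big_ord_recl !big_ord0.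
by case: (ord2 i) (ord2 j) => -> [] ->; rewrite ?(Od, Oa, Pd, Pa); ring.
Qed.

Lemma ifs_linear_similarity (R : realType) d (F : similarity_ifs R d) j :
  mx_similarity (ifs_ratio j) (@ifs_linear _ _ F j).
Proof.
apply: mx_similarity_orthogonal (ifs_orthP j).
by have /andP[/ltW] := ifs_ratioP j.
Qed.

Lemma similarity_fixpoint_unique (R : realType) d (r : R) (A : 'M[R]_d)
    (b x y : 'cV[R]_d) :
  r < 1 -> mx_similarity r A -> A *m x + b = x -> A *m y + b = y -> x = y.
Proof.
move=> r1 rA fx fy; apply/eqP; rewrite -subr_eq0; apply/eqP/enorm_eq0.
have := edist_affine b x y rA; rewrite fx fy edistE => xy.
have := enorm_ge0 (x - y); nra.
Qed.

(** A point of [K] farthest from [p] is the image of a point of [K] that is no farther from [p], so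
    the contraction forces its distance to be 0. *)
Lemma common_fixpoint_singleton (R : realType) d (F : similarity_ifs R d)
    (K : set 'cV[R]_d) p :
  generates F K -> (forall j, @ifs_map _ _ F j p = p) -> K = [set p].
Proof.
move=> [K0 cK KF] Fp.
suff Kp : K `<=` [set p].
  by apply/seteqP; split=> // _ ->; have [x Kx] := K0; rewrite -(Kp _ Kx).
have [|x /set_mem Kx xmax] :=
    @compact_EVT_max _ R (fun x : 'cV[R]_d => edist x p) K K0 cK.
  apply: continuous_subspaceT; apply: edist_continuous => i.
    exact: coord_continuous.
  exact: cst_continuous.
have xp : edist x p = 0.
  have := Kx; rewrite KF => -[j _ [y Ky yx]].
  have ryp : edist x p = ifs_ratio j * edist y p.
    rewrite -yx -{1}(Fp j); exact: edist_affine (ifs_linear_similarity j).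
  have /andP[r0 r1] := ifs_ratioP j.
  have := xmax _ (mem_set Ky); rewrite ryp => yle.
  suff -> : edist y p = 0 by rewrite mulr0.
  apply/eqP; rewrite eq_le [X in _ && X]sqrtr_ge0 andbT; nra.
move=> y Ky; apply/eqP; rewrite -subr_eq0; apply/eqP/enorm_eq0.
apply/eqP; rewrite eq_le enorm_ge0 andbT -edistE -xp.
exact: xmax (mem_set Ky).
Qed.

Lemma PDSP_of_commuting_squares (R : realType) d (F : similarity_ifs R d)
    (K : set 'cV[R]_d) :
  generates F K -> (~ exists x, K = [set x]) ->
  (forall i j, let S k := @ifs_linear _ _ F k *m ifs_linear k in
     S i *m S j = S j *m S i) ->
  PDSP K.
Proof.
move=> FK Kns SC; have [K0 cK KF] := FK.
have FKK j x : K x -> K (@ifs_map _ _ F j x).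
  by move=> Kx; rewrite KF; exists j => //; exists x.
pose S k := @ifs_linear _ _ F k *m ifs_linear k.
pose sq (k : 'I_(ifs_size F)) x := ifs_map k (ifs_map k x).
have sqE k x : sq k x = S k *m x + sq k 0.
  by rewrite /sq /ifs_map mulmx0 add0r mulmxDr mulmxA addrA.
have sqsqE i j x : sq i (sq j x) = (S i *m S j) *m x + sq i (sq j 0).
  by rewrite sqE (sqE j x) (sqE i (sq j 0)) mulmxDr mulmxA -addrA.
have ratio k : 0 < @ifs_ratio _ _ F k * ifs_ratio k < 1.
  have /andP[r0 r1] := ifs_ratioP k.
  rewrite mulr_gt0//=; nra.
have simS k : mx_similarity (ifs_ratio k * ifs_ratio k) (S k).
  by apply: mx_similarityM; exact: ifs_linear_similarity.
have [[i [j ij]]|sqC] :=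
    pselect (exists i j, sq i (sq j 0) != sq j (sq i 0)).
  apply: (PDSP_of_two_maps _ (mx_similarityM (simS i) (simS j)) ij) => //.
  - have /andP[i0 i1] := ratio i; have /andP[j0 j1] := ratio j.
    rewrite mulr_gt0//=; nra.
  - by move=> x Kx; rewrite -sqsqE; do 4 apply: (FKK).
  - by move=> x Kx; rewrite [S i *m S j]SC -sqsqE; do 4 apply: (FKK).
(* The linear parts agree by [SC], so equality at 0 makes the squares commute everywhere. *)
case: Kns; have {}sqC i j x : sq i (sq j x) = sq j (sq i x).
  rewrite sqsqE (sqsqE j) [S i *m S j]SC; congr (_ + _); apply/eqP.
  by apply: contrapT => /negP ij; apply: sqC; exists i, j.
have [i] : exists i : 'I_(ifs_size F), True.
  by have [x] := K0; rewrite KF => -[i _ _]; exists i.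
have /andP[_ ri] := ifs_ratioP i.
have [p Kp ip] := affine_fixpoint ri (ifs_linear_similarity i) K0 cK (FKK i).
exists p; apply: (common_fixpoint_singleton FK) => j.
have fixE k x : sq k x = x -> S k *m x + sq k 0 = x by rewrite -sqE.
have sqip : sq i p = p by rewrite /sq /ifs_map !ip.
have /andP[_ Ri] := ratio i; have /andP[_ Rj] := ratio j.
(* By commutation [sq j p] is a fixed point of [sq i], and [p] is the only one. *)
have sqjp : sq j p = p.
  apply: (similarity_fixpoint_unique Ri (simS i)); apply: fixE => //.
  by rewrite sqC sqip.
(* Likewise [ifs_map j p] is fixed by [sq j], whose only fixed point is [p]. *)
apply: (similarity_fixpoint_unique Rj (simS j)); apply: fixE => //.
by rewrite -[in RHS]sqjp.
Qed.

Theorem theorem1p3 (R : realType) (d : nat) (K : set 'cV[R]_d)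
    (hd : (1 <= d)%N)
    (hK : homogeneous_self_similar K \/
          ((d = 1%N \/ d = 2%N) /\ self_similar K))
    (hK1 : ~ exists x : 'cV[R]_d, K = [set x]) :
  PDSP K.
Proof.
case: hK => [[F FK Fh]|[d12 [F FK]]]; apply: (PDSP_of_commuting_squares FK hK1).
  by move=> i j /=; rewrite (Fh i j).
move=> i j /=; rewrite /ifs_linear -!(scalemxAl, scalemxAr).
rewrite (orthogonal_sqr_comm d12 (ifs_orthP i) (ifs_orthP j)).
by rewrite !scalerA; congr (_ *: _); ring.
Qed.
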